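(* Let $n\neq 1$ be a positive integer, let $F_q$ be the finite field with $q$ elements, and let $R$ be a finite unital ring. If $\varTheta(R)\cong\varTheta(M_n(F_q))$ as directed graphs, then $R\cong M_n(F_q)$ as rings.
   Context: For a finite unital ring $R$, define $a\sim b$ if and only if $a=bu=vb$ for some units $u,v\in R$; this is an equivalence relation, and $[a]$ denotes the class of $a$. $\varTheta(R)$ is the directed graph whose vertices are the classes $[a]$, $a\in R$, with a directed edge $[x]\to[y]$ ($[x]$, $[y]$ not necessarily distinct) if and only if $xy=0$ (this is well defined). *)

(* Defs.v *)
From HB Require Import structures.
From mathcomp Require Import all_boot all_order all_algebra.

Set Implicit Arguments.
Unset Strict Implicit.
Unset Printing Implicit Defensive.

Import GRing.Theory.
Local Open Scope ring_scope.

Section ZeroDivisorDigraph.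
Variable R : finPzRingType.
Implicit Types a b x y u v : R.

(* GRing.unit is not available here: it is part of the unitRingType structure,
   which a finPzRingType does not carry. *)
Definition is_unit u := [exists v, (u * v == 1) && (v * u == 1)].

Definition assoc a b :=
  [exists u, is_unit u && (a == b * u)] && [exists v, is_unit v && (a == v * b)].

Definition Theta_vertex :=
  {A : {set R} | A \in equivalence_partition assoc [set: R]}.

(* By Theta_edgeE below, the choice of the representatives x and y is
   immaterial. *)
Definition Theta : rel Theta_vertex := fun A B =>
  [exists x in val A, exists y in val B, x * y == 0].

Lemma is_unit1 : is_unit 1.
Proof. by apply/existsP; exists 1; rewrite mulr1 eqxx. Qed.

Lemma is_unitM u v : is_unit u -> is_unit v -> is_unit (u * v).
Proof.
move=> /existsP[u' /andP[/eqP uu' /eqP u'u]].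
move=> /existsP[v' /andP[/eqP vv' /eqP v'v]].
apply/existsP; exists (v' * u'); apply/andP; split; apply/eqP.
  by rewrite mulrA -(mulrA u) vv' mulr1.
by rewrite mulrA -(mulrA v') u'u mulr1.
Qed.

Lemma assocP a b :
  reflect ((exists2 u, is_unit u & a = b * u) /\
           (exists2 v, is_unit v & a = v * b)) (assoc a b).
Proof.
apply: (iffP andP) => -[].
  move=> /existsP[u /andP[uu /eqP au]] /existsP[v /andP[uv /eqP av]].
  by split; [exists u | exists v].
move=> [u uu au] [v uv av]; split; apply/existsP.
  by exists u; rewrite uu; apply/eqP.
by exists v; rewrite uv; apply/eqP.
Qed.

Lemma assoc_refl : reflexive assoc.
Proof.
by move=> a; apply/assocP; split; exists 1;
  rewrite ?is_unit1 ?mulr1 ?mul1r.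
Qed.

Lemma assoc_sym : symmetric assoc.
Proof.
suff sub a b : assoc a b -> assoc b a by move=> a b; apply/idP/idP; apply: sub.
case/assocP=> -[u /existsP[u' /andP[/eqP uu' /eqP u'u]] au].
case=> [v /existsP[v' /andP[/eqP vv' /eqP v'v]] av].
apply/assocP; split.
  exists u'; last by rewrite au -mulrA uu' mulr1.
  by apply/existsP; exists u; rewrite uu' u'u eqxx.
exists v'; last by rewrite av mulrA v'v mul1r.
by apply/existsP; exists v; rewrite vv' v'v eqxx.
Qed.

Lemma assoc_trans : transitive assoc.
Proof.
move=> b a c /assocP[[u uu au] [v uv av]] /assocP[[u' uu' bu'] [v' uv' bv']].
apply/assocP; split.
  by exists (u' * u); [exact: is_unitM | rewrite au bu' mulrA].
by exists (v * v'); [exact: is_unitM | rewrite av bv' mulrA].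
Qed.

Lemma assoc_equivalence : {in [set: R] & &, equivalence_rel assoc}.
Proof.
move=> a b c _ _ _; split=> [|ab]; first exact: assoc_refl.
by apply/idP/idP; apply: assoc_trans; rewrite // assoc_sym.
Qed.

Lemma class_subproof a :
  [set b in [set: R] | assoc a b] \in equivalence_partition assoc [set: R].
Proof. exact: imset_f. Qed.

Definition class a : Theta_vertex :=
  exist _ [set b in [set: R] | assoc a b] (class_subproof a).

Lemma class_eq a b : (class a == class b) = assoc a b.
Proof.
apply/eqP/idP => [/(congr1 val)/= /setP/(_ b)|ab].
  by rewrite !inE /= assoc_refl.
apply/val_inj/setP=> c; rewrite !inE /=.
by have [_ ->] := @assoc_equivalence a b c (in_setT _) (in_setT _) (in_setT _).
Qed.

Lemma class_surj (A : Theta_vertex) : exists a, A = class a.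
Proof.
case: A => A memA; have /imsetP[a _ Aa] := memA.
by exists a; apply: val_inj.
Qed.

Lemma Theta_edgeE x y : Theta (class x) (class y) = (x * y == 0).
Proof.
apply/existsP/idP => [[x' /andP[+ /existsP[y' /andP[+ /eqP xy0]]]]|xy0].
  rewrite !inE /= => /assocP[_ [v uv ->]] /assocP[[u uu ->] _].
  by rewrite mulrA -(mulrA v) xy0 mulr0 mul0r.
exists x; rewrite !inE assoc_refl; apply/existsP.
by exists y; rewrite !inE assoc_refl.
Qed.

End ZeroDivisorDigraph.

Definition digraph_iso (V W : Type) (e : rel V) (e' : rel W) :=
  exists2 f : V -> W, bijective f & forall x y, e' (f x) (f y) = e x y.

Definition ring_iso (R S : pzRingType) :=
  exists f : {rmorphism R -> S}, bijective f.

(* Main.v *)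
(* An isomorphism of digraphs amounts to a map [phi] from M_n(F) to R that is
   onto up to association and satisfies phi x * phi y = 0 iff x * y = 0.
   The elements phi(E_ii) are pairwise orthogonal and their sum is a unit;
   dividing by it yields orthogonal idempotents e_i with sum 1. Any r in e_i R e_j
   is associate to some phi x with x a multiple of E_ij, so the corner e_0 R e_0
   is a division ring, hence a finite field K by Wedderburn, and the phi(E_i0),
   phi(E_0i) can be rescaled to a system of matrix units: R = M_n(K). Finally, for
   n > 1, the classes of the elements E_00 + c E_01 are told apart by their right
   annihilators on both sides, so that K and F have the same cardinality. *)

From HB Require Import structures.
From mathcomp Require Import all_boot all_order all_algebra.
From mathcomp Require Import all_fingroup cyclic finfield.
Require Import Defs.

Set Implicit Arguments.
Unset Strict Implicit.
Unset Printing Implicit Defensive.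

Import GRing.Theory.
Local Open Scope ring_scope.

Lemma finField_generator (F : finFieldType) :
  exists g : F, forall x, x != 0 -> exists i, x = g ^+ i.
Proof.
have /cyclicP[u genu] : cyclic [set: {unit F}].
  exact: field_unit_group_cyclic.
exists (val u) => x nzx; have Ux : x \is a GRing.unit by rewrite unitfE.
have /cycleP[i xi] : FinRing.unit F Ux \in <[u]>%g by rewrite -genu inE.
by exists i; rewrite -FinRing.val_unitX -xi.
Qed.

(* Both fields are quotients of 'F_p[X]: evaluation at a generator [g] of the
   unit group of [F], and at a root [h] in [K] of the minimal polynomial of [g],
   which exists because that polynomial divides X^#|F| - X. *)
Lemma finField_isom (F K : finFieldType) :
  #|F| = #|K| -> exists f : {rmorphism F -> K}, bijective f.
Proof.
move=> cardFK; have [p p_pr charF] := finPcharP F.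
have charK : p \in [pchar K].
  apply: (@card_finPcharP K p (logn p #|F|)) => //.
  by rewrite -cardFK; exact: card_pprimeChar charF.
pose A := pPrimeCharType charF; pose B := pPrimeCharType charK.
have [g gen_g] := finField_generator F.
pose ev : {rmorphism {poly 'F_p} -> A} := horner_alg (g : A).
have ev_surj (x : A) : exists P, ev P == x.
  have [->|/gen_g[i ->]] := eqVneq x 0; first by exists 0; rewrite rmorph0.
  by exists ('X^i); rewrite rmorphXn /= horner_algX.
have ev_genPoly : ev ('X^#|F| - 'X) = 0.
  by rewrite rmorphB rmorphXn /= horner_algX [g ^+ _]expf_card subrr.
pose n := #|F|.+1.
pose ker (v : 'rV['F_p]_n) := (ev (rVpoly v) == 0) && (rVpoly v != 0).
have szGP : size ('X^#|F| - 'X : {poly 'F_p}) = n.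
  rewrite size_polyDl size_polyXn // size_polyN size_polyX ltnS.
  exact: finNzRing_gt1.
have ker0 : ker (poly_rV ('X^#|F| - 'X)).
  by rewrite /ker poly_rV_K ?szGP // ev_genPoly eqxx -size_poly_eq0 szGP.
pose v := [arg min_(v < poly_rV ('X^#|F| - 'X) | ker v) size (rVpoly v)].
have [kerv vmin] :
    ker v /\ forall w, ker w -> (size (rVpoly v) <= size (rVpoly w))%N.
  by rewrite /v; case: arg_minnP.
move: kerv => /andP[/eqP Pg0 nzP]; set P := rVpoly v in Pg0 nzP vmin.
have Pdvd Q : ev Q = 0 -> P %| Q.
  move=> Qg0; have ltr : (size (Q %% P)%R < size P)%N by rewrite ltn_modp.
  apply: contraLR (ltr) => nzr.
  have szr : (size (Q %% P)%R <= n)%N.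
    by rewrite (leq_trans _ (size_poly _ _ : size P <= n)%N) // ltnW.
  rewrite -leqNgt -(poly_rV_K szr) vmin // /ker poly_rV_K // nzr andbT.
  have : ev Q = 0 by [].
  by rewrite {1}(divp_eq Q P) rmorphD rmorphM /= Pg0 mulr0 add0r => ->.
have [h rooth] : exists h : B, horner_alg h P = 0.
  have : map_poly (in_alg B) P %| \prod_(x : K) ('X - x%:P).
    rewrite -finField_genPoly -cardFK.
    have -> : 'X^#|F| - 'X = map_poly (in_alg B) ('X^#|F| - 'X) :> {poly K}.
      by rewrite rmorphB /= map_polyXn map_polyX.
    by rewrite dvdp_map; apply: Pdvd.
  rewrite -big_enum /= => /dvdp_prod_XsubC[m].
  set s := mask _ _ => eqPs; case Ds : s eqPs => [|h s'] eqPs.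
    move: eqPs; rewrite big_nil => /eqp_size; rewrite size_map_poly size_poly1.
    move/eqP/size_poly1P=> [c nzc Pc]; move: Pg0; rewrite Pc /ev.
    rewrite /= horner_algC => /eqP.
    by rewrite scaler_eq0 oner_eq0 orbF (negPf nzc).
  exists h; have : root (\prod_(x <- h :: s') ('X - x%:P)) h.
    by rewrite root_prod_XsubC mem_head.
  by rewrite -(eqp_root eqPs) => /rootP.
pose eh : {rmorphism {poly 'F_p} -> B} := horner_alg h.
pose lift x := xchoose (ev_surj x); pose f (x : F) : K := eh (lift x).
have liftP x : ev (lift x) = x by apply/eqP/(xchooseP (ev_surj x)).
have fE Q x : ev Q = x -> f x = eh Q.
  move=> Qx; apply/eqP; rewrite -subr_eq0 /f -rmorphB /=.
  have /dvdpP[S ->] : P %| lift x - Q.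
    by apply: Pdvd; rewrite rmorphB /= liftP Qx subrr.
  by rewrite rmorphM /= [X in _ * X]rooth mulr0.
have f_add : zmod_morphism f.
  by move=> x y; rewrite (fE (lift x - lift y)) rmorphB //= !liftP.
have f_mul : monoid_morphism f.
  split=> [|x y]; first by rewrite (fE 1) rmorph1.
  by rewrite (fE (lift x * lift y)) rmorphM //= !liftP.
pose fA := GRing.isZmodMorphism.Build F K f f_add.
pose fM := GRing.isMonoidMorphism.Build F K f f_mul.
pose fR : {rmorphism F -> K} := HB.pack f fA fM.
by exists fR; apply: inj_card_bij; rewrite ?cardFK //; apply: fmorph_inj.
Qed.

Section Corner.

Variables (R : finPzRingType) (e : R).
Hypotheses (ee : e * e = e) (nze : e != 0).

Record corner :=
  Corner { corner_val :> R; _ : e * corner_val * e == corner_val }.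

HB.instance Definition _ := [isSub for corner_val].
HB.instance Definition _ := [Finite of corner by <:].

Implicit Types x y : corner.

Lemma cornerP x : e * val x * e = val x.
Proof. exact/eqP/(valP x). Qed.

Lemma mul_id_corner x : e * val x = val x.
Proof. by rewrite -(cornerP x) !mulrA ee. Qed.

Lemma mul_corner_id x : val x * e = val x.
Proof. by rewrite -(cornerP x) -mulrA ee. Qed.

Fact corner0_subproof : e * 0 * e == 0. Proof. by rewrite mulr0 mul0r. Qed.
Fact cornerN_subproof x : e * - val x * e == - val x.
Proof. by rewrite mulrN mulNr cornerP. Qed.
Fact cornerD_subproof x y : e * (val x + val y) * e == val x + val y.
Proof. by rewrite mulrDr mulrDl !cornerP. Qed.
Fact corner1_subproof : e * e * e == e. Proof. by rewrite !ee. Qed.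
Fact cornerM_subproof x y : e * (val x * val y) * e == val x * val y.
Proof. by rewrite mulrA mul_id_corner -mulrA mul_corner_id. Qed.

Definition corner0 := Corner corner0_subproof.
Definition cornerN x := Corner (cornerN_subproof x).
Definition cornerD x y := Corner (cornerD_subproof x y).
Definition corner1 := Corner corner1_subproof.
Definition cornerM x y := Corner (cornerM_subproof x y).

Lemma corner_addA : associative cornerD.
Proof. by move=> x y z; apply/val_inj/addrA. Qed.
Lemma corner_addC : commutative cornerD.
Proof. by move=> x y; apply/val_inj/addrC. Qed.
Lemma corner_add0 : left_id corner0 cornerD.
Proof. by move=> x; apply/val_inj/add0r. Qed.
Lemma corner_addN : left_inverse corner0 cornerN cornerD.
Proof. by move=> x; apply/val_inj/addNr. Qed.

HB.instance Definition _ := GRing.isZmodule.Build corner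
  corner_addA corner_addC corner_add0 corner_addN.

Lemma corner_mulA : associative cornerM.
Proof. by move=> x y z; apply/val_inj/mulrA. Qed.
Lemma corner_mul1 : left_id corner1 cornerM.
Proof. by move=> x; apply/val_inj/mul_id_corner. Qed.
Lemma corner_mulr1 : right_id corner1 cornerM.
Proof. by move=> x; apply/val_inj/mul_corner_id. Qed.
Lemma corner_mulDl : left_distributive cornerM cornerD.
Proof. by move=> x y z; apply/val_inj/mulrDl. Qed.
Lemma corner_mulDr : right_distributive cornerM cornerD.
Proof. by move=> x y z; apply/val_inj/mulrDr. Qed.
Lemma corner_oner_neq0 : corner1 != 0 :> corner.
Proof. by rewrite -val_eqE. Qed.

HB.instance Definition _ := GRing.Zmodule_isNzRing.Build corner
  corner_mulA corner_mul1 corner_mulr1 corner_mulDl corner_mulDr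
  corner_oner_neq0.
HB.instance Definition _ := FinRing.isNzRing.Build corner.

Lemma corner_field :
  (forall s, e * s * e = s -> s != 0 -> exists2 t, e * t * e = t & s * t = e) ->
  exists (K : finFieldType) (theta : K -> R),
    [/\ injective theta, theta 1 = e, {morph theta : z t / z - t},
        {morph theta : z t / z * t} &
        forall s, e * s * e = s <-> exists z, theta z = s].
Proof.
move=> inv; have dom : GRing.integral_domain_axiom (corner : finUnitRingType).
  move=> x y xy0; have [//|nzx] := eqVneq x 0.
  have unitl (u : corner) : u != 0 -> exists v : corner, u * v = 1.
    move=> nzu; have [t /eqP te ut] := inv (val u) (cornerP u) nzu.
    by exists (Corner te); apply: val_inj.
  have [x' xx'] := unitl x nzx.
  have nzx' : x' != 0.
    by apply: contra_eq_neq xx' => ->; rewrite mulr0 eq_sym oner_eq0.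
  have [x'' x'x''] := unitl x' nzx'.
  have x'x : x' * x = 1.
    by rewrite -[RHS]x'x'' -[x'']mul1r -xx' -mulrA x'x'' mulr1.
  by rewrite -[y]mul1r -x'x -mulrA xy0 mulr0 eqxx.
exists (FinDomainFieldType dom), (val : corner -> R); split=> //.
- exact: val_inj.
- move=> s; split=> [/eqP es|[x <-]]; last exact: cornerP.
  by exists (Corner es).
Qed.

End Corner.

Lemma finRing_lreg_unit (R : finPzRingType) (w : R) :
  (forall r, w * r = 0 -> r = 0) -> exists2 t, w * t = 1 & t * w = 1.
Proof.
move=> lregw; have injw : injective ( *%R w).
  by move=> r s /eqP; rewrite -subr_eq0 -mulrBr => /eqP/lregw/subr0_eq.
have wt := f_invF injw 1; exists (invF injw 1) => //; apply: (injw).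
by rewrite mulrA wt mul1r mulr1.
Qed.

Section ThetaMatrix.

Variables (m : nat) (F : finFieldType) (R : finPzRingType).
Variable phi : 'M[F]_m.+1 -> R.
Hypothesis phi_mul0 : forall x y, (phi x * phi y == 0) = (x * y == 0).
Hypothesis phi_surj : forall r, exists x, class r = class (phi x).

Implicit Types (r s t w : R) (x y : 'M[F]_m.+1) (i j k : 'I_m.+1) (c d : F).

Local Notation E := (@delta_mx F m.+1 m.+1).

Lemma row_delta_mul0 i j x : E i j * x = 0 -> forall l, x j l = 0.
Proof.
move=> Ex0 l; have := congr1 (fun A : 'M_m.+1 => A i l) Ex0; rewrite !mxE.
rewrite (bigD1 j) //= big1 ?addr0 ?mxE ?eqxx ?mul1r // => k /negPf kj.
by rewrite mxE kj andbF mul0r.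
Qed.

Lemma col_mul_delta0 i j x : x * E i j = 0 -> forall l, x l i = 0.
Proof.
move=> Ex0 l; have := congr1 (fun A : 'M_m.+1 => A l j) Ex0; rewrite !mxE.
rewrite (bigD1 i) //= big1 ?addr0 ?mxE ?eqxx ?mulr1 // => k /negPf ki.
by rewrite mxE ki mulr0.
Qed.

Lemma delta_mx_mul i j k l : E i j * E k l = (E i l) *+ (j == k).
Proof. exact: mul_delta_mx_cond. Qed.

Lemma delta_mx_neq0 i j : E i j != 0.
Proof.
by apply/eqP=> /matrixP/(_ i j); rewrite !mxE !eqxx => /eqP; rewrite oner_eq0.
Qed.

Lemma class_mul0 r s x y : class r = class (phi x) -> class s = class (phi y) ->
  (r * s == 0) = (x * y == 0).
Proof. by move=> rx sy; rewrite -Theta_edgeE rx sy Theta_edgeE phi_mul0. Qed.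

Lemma class_eq0 r x : class r = class (phi x) -> (r == 0) = (x == 0).
Proof.
move=> rx; have [y y1] := phi_surj 1; apply/eqP/eqP=> [r0|x0].
  apply/eqP; rewrite -[x]mulr1 -(class_mul0 rx (erefl (class (phi 1)))).
  by rewrite r0 mul0r.
by apply/eqP; rewrite -[r]mulr1 (class_mul0 rx y1) x0 mul0r.
Qed.

Lemma phi_delta_mul0 i r x : class r = class (phi x) ->
  (phi (E i i) * r == 0) = (E i i * x == 0).
Proof. exact: class_mul0. Qed.

Lemma phi_delta_sep r : (forall i, phi (E i i) * r = 0) -> r = 0.
Proof.
have [x rx] := phi_surj r => Xr0; apply/eqP; rewrite (class_eq0 rx); apply/eqP.
apply/matrixP=> i j; rewrite mxE; apply: (@row_delta_mul0 i).
by apply/eqP; rewrite -(phi_delta_mul0 _ rx) Xr0.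
Qed.

Lemma exists_frame : exists e : 'I_m.+1 -> R,
  [/\ \sum_i e i = 1, forall i j, i != j -> e i * e j = 0,
      forall i r, (e i * r == 0) = (phi (E i i) * r == 0) &
      forall i r, (r * e i == 0) = (r * phi (E i i) == 0)].
Proof.
pose X i := phi (E i i).
have XX i j : i != j -> X i * X j = 0.
  by move=> /negPf ij; apply/eqP; rewrite phi_mul0 delta_mx_mul ij.
pose u := \sum_i X i.
have uX i : u * X i = X i * X i.
  rewrite mulr_suml (bigD1 i) //= big1 ?addr0 // => j ji; exact: XX.
have Xu i : X i * u = X i * X i.
  rewrite mulr_sumr (bigD1 i) //= big1 ?addr0 // => j ji.
  by apply: XX; rewrite eq_sym.
have [v uv vu] : exists2 v, u * v = 1 & v * u = 1.
  apply: finRing_lreg_unit => r ur0; apply: phi_delta_sep => i.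
  apply: phi_delta_sep => j; rewrite -/(X i) -/(X j) mulrA.
  have [->|ji] := eqVneq j i; last by rewrite XX ?mul0r.
  by rewrite -Xu -mulrA ur0 mulr0.
have vX i : v * X i = X i * v.
  by rewrite -[LHS]mulr1 -uv mulrA -[v * _ * _]mulrA Xu -uX !mulrA vu mul1r.
exists (fun i => X i * v); split.
- by rewrite -mulr_suml.
- by move=> i j ij; rewrite -vX -mulrA [X i * _]mulrA XX // mul0r mulr0.
- move=> i r; rewrite -/(X i) -vX -mulrA; apply/eqP/eqP=> [vXr|->].
    by rewrite -[LHS]mul1r -uv -mulrA vXr mulr0.
  by rewrite mulr0.
- move=> i r; rewrite -/(X i) mulrA; apply/eqP/eqP=> [rXv|->].
    by rewrite -[LHS]mulr1 -vu mulrA rXv mul0r.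
  by rewrite mul0r.
Qed.

Section Frame.

Variable e : 'I_m.+1 -> R.
Hypothesis sum_e : \sum_i e i = 1.
Hypothesis e_orth : forall i j, i != j -> e i * e j = 0.
Hypothesis e_mul0 : forall i r, (e i * r == 0) = (phi (E i i) * r == 0).
Hypothesis mul_e0 : forall i r, (r * e i == 0) = (r * phi (E i i) == 0).

Lemma e_mul_supp k r : (forall i, i != k -> e i * r = 0) -> e k * r = r.
Proof.
move=> er0; rewrite -[RHS]mul1r -sum_e mulr_suml (bigD1 k) //= big1 ?addr0 //.
Qed.

Lemma mul_e_supp k r : (forall i, i != k -> r * e i = 0) -> r * e k = r.
Proof.
move=> er0; rewrite -[RHS]mulr1 -sum_e mulr_sumr (bigD1 k) //= big1 ?addr0 //.
Qed.

Lemma e_idem k : e k * e k = e k.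
Proof. by apply: e_mul_supp => i ik; apply: e_orth. Qed.

Lemma row_class_eq0 r x k : class r = class (phi x) ->
  e k * r = 0 -> forall l, x k l = 0.
Proof.
move=> rx /eqP; rewrite e_mul0 (phi_delta_mul0 k rx) => /eqP.
exact: row_delta_mul0.
Qed.

Lemma col_class_eq0 r x k : class r = class (phi x) ->
  r * e k = 0 -> forall l, x l k = 0.
Proof.
move=> rx /eqP; rewrite mul_e0 (class_mul0 rx (erefl _)) => /eqP.
exact: col_mul_delta0.
Qed.

Lemma e_mul_phi k x : (forall i, i != k -> E i i * x = 0) ->
  e k * phi x = phi x.
Proof.
move=> Ex0; apply: e_mul_supp => i ik; apply/eqP; rewrite e_mul0 phi_mul0.
by rewrite Ex0.
Qed.

Lemma phi_mul_e k x : (forall i, i != k -> x * E i i = 0) ->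
  phi x * e k = phi x.
Proof.
move=> Ex0; apply: mul_e_supp => i ik; apply/eqP; rewrite mul_e0 phi_mul0.
by rewrite Ex0.
Qed.

Lemma e_mul_phi_delta i j : e i * phi (E i j) = phi (E i j).
Proof. by apply: e_mul_phi => k /negPf ki; rewrite delta_mx_mul ki. Qed.

Lemma phi_delta_mul_e i j : phi (E i j) * e j = phi (E i j).
Proof.
by apply: phi_mul_e => k /negPf kj; rewrite delta_mx_mul eq_sym kj.
Qed.

Lemma e_mul_orth k i r : e k * r = r -> i != k -> e i * r = 0.
Proof. by move=> <- ik; rewrite mulrA e_orth // mul0r. Qed.

Lemma mul_e_orth k i r : r * e k = r -> i != k -> r * e i = 0.
Proof. by move=> <- ik; rewrite -mulrA e_orth ?mulr0 // eq_sym. Qed.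

Lemma e_neq0 k : e k != 0.
Proof.
by rewrite -[e k]mulr1 e_mul0 mulr1 (class_eq0 (erefl _)) delta_mx_neq0.
Qed.

Lemma corner_lreg k s r : s * e k = s -> e k * s = s -> s != 0 ->
  e k * r = r -> s * r = 0 -> r = 0.
Proof.
move=> se es nzs er; have [x sx] := phi_surj s; have [y ry] := phi_surj r.
move=> /eqP; rewrite (class_mul0 sx ry) => /eqP xy0.
have row0 i l : i != k -> x i l = 0.
  by move=> ik; apply: (row_class_eq0 sx); apply: e_mul_orth ik.
have col0 i l : i != k -> x l i = 0.
  by move=> ik; apply: (col_class_eq0 sx); apply: mul_e_orth ik.
apply/eqP; rewrite (class_eq0 ry); apply/eqP/matrixP=> i j; rewrite mxE.
have [->|ik] := eqVneq i k; last first.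
  by apply: (row_class_eq0 ry); apply: e_mul_orth ik.
have nzx : x k k != 0.
  move: nzs; rewrite (class_eq0 sx); apply: contra_neq => xkk0.
  apply/matrixP=> p q; rewrite mxE; have [->|] := eqVneq p k; last exact: row0.
  by have [->|] := eqVneq q k; last exact: col0.
apply/eqP; have := congr1 (fun A : 'M_m.+1 => A k j) xy0; rewrite !mxE.
rewrite (bigD1 k) //= big1 ?addr0 => [/eqP|p pk]; last by rewrite col0 ?mul0r.
by rewrite mulf_eq0 (negPf nzx).
Qed.

Lemma corner_inv k s : e k * s * e k = s -> s != 0 ->
  exists t, [/\ e k * t * e k = t, s * t = e k & t * s = e k].
Proof.
move=> ese nzs.
have es : e k * s = s by rewrite -ese !mulrA e_idem.
have se : s * e k = s by rewrite -ese -mulrA e_idem.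
pose w := 1 - e k + s.
have ew : e k * w = s by rewrite mulrDr mulrBr mulr1 e_idem subrr add0r.
have we : w * e k = s by rewrite mulrDl mulrBl mul1r e_idem subrr add0r.
have [r wr rw] : exists2 r, w * r = 1 & r * w = 1.
  apply: finRing_lreg_unit => r wr0; have sr0 : s * r = 0.
    by rewrite -ew -mulrA wr0 mulr0.
  apply: (corner_lreg se es nzs) => //; apply/esym.
  by move: wr0; rewrite mulrDl sr0 addr0 mulrBl mul1r => /subr0_eq.
have sr : s * r = e k by rewrite -ew -mulrA wr mulr1.
have rs : r * s = e k by rewrite -we mulrA rw mul1r.
exists (e k * r * e k); split.
- by rewrite !mulrA e_idem -mulrA e_idem.
- by rewrite !mulrA se sr e_idem.
- by rewrite -mulrA es -mulrA rs e_idem.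
Qed.

Lemma exists_matrix_units : exists a b : 'I_m.+1 -> R,
  [/\ forall i, e i * a i = a i /\ a i * e 0 = a i,
      forall i, e 0 * b i = b i /\ b i * e i = b i,
      forall i, b i * a i = e 0 & forall i, a i * b i = e i].
Proof.
pose a i := phi (E i 0); pose c i := phi (E 0 i).
have ca i : exists t, [/\ e 0 * t * e 0 = t, c i * a i * t = e 0 &
                          t * (c i * a i) = e 0].
  apply: corner_inv.
    by rewrite mulrA /c e_mul_phi_delta -mulrA /a phi_delta_mul_e.
  by rewrite phi_mul0 delta_mx_mul eqxx delta_mx_neq0.
have [t tP] := fin_all_exists ca.
have ct i : c i * a i * t i = e 0 by case: (tP i).
have tc i : t i * (c i * a i) = e 0 by case: (tP i).
have et i : e 0 * t i = t i by case: (tP i) => <- _ _; rewrite !mulrA e_idem.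
exists a, (fun i => t i * c i); split=> i.
- by rewrite /a e_mul_phi_delta phi_delta_mul_e.
- by rewrite mulrA et -mulrA /c phi_delta_mul_e.
- by rewrite -mulrA tc.
have [y dy] := phi_surj (a i * (t i * c i) - e i).
apply/eqP; rewrite -subr_eq0 (class_eq0 dy); apply/eqP/matrixP=> k l.
rewrite [RHS]mxE; have [->|ki] := eqVneq k i; last first.
  apply: (row_class_eq0 dy); apply: (e_mul_orth _ ki).
  by rewrite mulrBr e_idem [e i * (_ * _)]mulrA /a e_mul_phi_delta.
apply: (@row_delta_mul0 0); apply/eqP; rewrite -(class_mul0 (erefl _) dy).
by rewrite -/(c i) mulrBr !mulrA ct /c e_mul_phi_delta phi_delta_mul_e subrr.
Qed.

Section FieldSize.

Variables (a b : 'I_m.+1 -> R) (K : finFieldType) (theta : K -> R).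
Variable o : 'I_m.+1.
Hypothesis o_neq0 : o != 0.
Hypothesis aP : forall i, e i * a i = a i /\ a i * e 0 = a i.
Hypothesis bP : forall i, e 0 * b i = b i /\ b i * e i = b i.
Hypothesis ba : forall i, b i * a i = e 0.
Hypothesis ab : forall i, a i * b i = e i.
Hypothesis theta_inj : injective theta.
Hypothesis thetaP : forall s, e 0 * s * e 0 = s <-> exists z, theta z = s.

Implicit Type z : K.

Lemma e0_theta z : e 0 * theta z = theta z.
Proof.
have <- : e 0 * theta z * e 0 = theta z by apply/thetaP; exists z.
by rewrite !mulrA e_idem.
Qed.

Lemma theta_e0 z : theta z * e 0 = theta z.
Proof.
have <- : e 0 * theta z * e 0 = theta z by apply/thetaP; exists z.
by rewrite -mulrA e_idem.
Qed.

Definition same_annihilator c z := forall r,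
  (phi (E 0 0 + c *: E 0 o) * r == 0) = ((e 0 + theta z * b o) * r == 0).

Lemma exists_corner_coeff c : exists z, same_annihilator c z.
Proof.
set x := E 0 0 + c *: E 0 o; set v := phi x.
have ev : e 0 * v = v.
  apply: e_mul_phi => i /negPf i0; rewrite mulrDr -scalerAr !delta_mx_mul i0.
  by rewrite scaler0 addr0.
have ve i : i != 0 -> i != o -> v * e i = 0.
  move=> /negPf i0 /negPf io; apply/eqP; rewrite mul_e0 phi_mul0 mulrDl.
  by rewrite -scalerAl !delta_mx_mul ![_ == i]eq_sym i0 io scaler0 addr0.
have nzs : v * e 0 != 0.
  rewrite mul_e0 phi_mul0 mulrDl -scalerAl !delta_mx_mul (negPf o_neq0).
  by rewrite scaler0 addr0 eqxx delta_mx_neq0.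
have [t [ete st ts]] : exists t, [/\ e 0 * t * e 0 = t,
    v * e 0 * t = e 0 & t * (v * e 0) = e 0].
  by apply: corner_inv; rewrite // mulrA ev -mulrA e_idem.
have et : e 0 * t = t by rewrite -ete !mulrA e_idem.
have [z zP] : exists z, theta z = t * v * a o.
  by apply/thetaP; rewrite !mulrA et -mulrA (aP o).2.
have tvE : t * v = e 0 + theta z * b o.
  rewrite zP -[t * v * _ * _]mulrA ab -[LHS]mulr1 -sum_e mulr_sumr.
  rewrite (bigD1 0) //= (bigD1 o) //= big1 => [|i /andP[i0 io]].
    by rewrite addr0 -[t * v * e 0]mulrA ts.
  by rewrite -mulrA ve ?mulr0.
exists z => r; rewrite -tvE -/x -/v; apply/eqP/eqP=> [vr|tvr].
  by rewrite -mulrA vr mulr0.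
by rewrite -ev -st -[_ * t * v]mulrA -mulrA tvr mulr0.
Qed.

Lemma exists_matrix_coeff z : exists c, same_annihilator c z.
Proof.
set w := e 0 + theta z * b o; have [x wx] := phi_surj w.
have ew : e 0 * w = w by rewrite mulrDr e_idem mulrA e0_theta.
have be i : i != o -> b o * e i = 0 by apply: mul_e_orth; case: (bP o).
have row0 i l : i != 0 -> x i l = 0.
  by move=> i0; apply: (row_class_eq0 wx); apply: e_mul_orth i0.
have col0 i l : i != 0 -> i != o -> x l i = 0.
  move=> i0 io; apply: (col_class_eq0 wx).
  by rewrite mulrDl -mulrA be ?mulr0 ?addr0 ?e_orth // eq_sym.
have nzx : x 0 0 != 0.
  have : w * e 0 != 0.
    by rewrite mulrDl e_idem -mulrA be ?mulr0 ?addr0 ?e_neq0 // eq_sym.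
  rewrite mul_e0 (class_mul0 wx (erefl _)); apply: contra_neq => x00.
  apply/matrixP=> i j; rewrite !mxE big1 // => k _; rewrite mxE.
  have [->|k0] := eqVneq k 0; last by rewrite /= mulr0.
  by have [->|i0] := eqVneq i 0; rewrite ?x00 ?row0 // mul0r.
pose c := x 0 o / x 0 0; exists c => r; have [y ry] := phi_surj r.
rewrite (class_mul0 wx ry) (class_mul0 (erefl _) ry).
suff -> : x = x 0 0 *: (E 0 0 + c *: E 0 o).
  by rewrite -scalerAl scaler_eq0 (negPf nzx).
apply/matrixP=> i j; rewrite !mxE.
have [->|i0] := eqVneq i 0; last by rewrite row0 // !mulr0 addr0 mulr0.
have [->|j0] := eqVneq j 0.
  by rewrite eq_sym (negPf o_neq0) mulr0 addr0 mulr1.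
have [->|jo] := eqVneq j o; last by rewrite col0 // mulr0 addr0 mulr0.
by rewrite add0r mulr1 mulrC divfK.
Qed.

Lemma same_annihilator_injl c d z :
  same_annihilator c z -> same_annihilator d z -> d = c.
Proof.
move=> cz dz; have := cz (phi (E o 0 - c *: E 0 0)); rewrite -dz !phi_mul0.
have calc u : (E 0 0 + u *: E 0 o) * (E o 0 - c *: E 0 0) = (u - c) *: E 0 0.
  rewrite mulrDl !mulrBr -!scalerAl -!scalerAr !delta_mx_mul !eqxx.
  rewrite [0 == o]eq_sym (negPf o_neq0) mulr0n !mulr1n !scaler0 sub0r subr0.
  by rewrite addrC -scalerBl.
rewrite !calc subrr scale0r eqxx scaler_eq0 (negPf (delta_mx_neq0 _ _)) orbF.
by move/esym/eqP/subr0_eq.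
Qed.

Lemma same_annihilator_injr c z z' :
  same_annihilator c z -> same_annihilator c z' -> z = z'.
Proof.
move=> cz cz'; have := cz (a o - theta z); rewrite cz'.
have ea : e 0 * a o = 0.
  by apply: e_mul_orth (aP o).1 _; rewrite eq_sym.
have bth u : b o * theta u = 0.
  by rewrite -(e0_theta u) mulrA (mul_e_orth (bP o).2) ?mul0r // eq_sym.
have calc u : (e 0 + theta u * b o) * (a o - theta z) = theta u - theta z.
  rewrite mulrDl !mulrBr ea sub0r e0_theta -!mulrA ba bth mulr0 subr0 theta_e0.
  exact: addrC.
by rewrite !calc subrr eqxx subr_eq0 => /eqP/theta_inj.
Qed.

Lemma card_corner_field : #|F| = #|K|.
Proof.
have [f fP] := fin_all_exists exists_corner_coeff.
have [g gP] := fin_all_exists exists_matrix_coeff.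
apply/eqP; rewrite eqn_leq; apply/andP; split.
  apply: (leq_card f) => c d fcd; apply: (same_annihilator_injl (fP d)).
  by rewrite -fcd.
apply: (leq_card g) => z z' gzz; apply: (same_annihilator_injr (gP z)).
by rewrite gzz.
Qed.

End FieldSize.
End Frame.
End ThetaMatrix.

Lemma matrix_units_ring_iso (m : nat) (F : finFieldType) (R : finPzRingType)
    (a b : 'I_m.+1 -> R) (e : R) (theta : F -> R) :
  (forall i, a i * e = a i) -> (forall i, e * b i = b i) ->
  (forall i j, b i * a j = e *+ (i == j)) -> \sum_i a i * b i = 1 ->
  injective theta -> theta 1 = e -> {morph theta : x y / x - y} ->
  {morph theta : x y / x * y} ->
  (forall s, e * s * e = s <-> exists x, theta x = s) ->
  ring_iso R 'M[F]_m.+1.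
Proof.
move=> ae eb ba ab1 th_inj th1 thB thM thP.
have th0 : theta 0 = 0 by rewrite -(subrr 0) thB subrr.
have thD : {morph theta : x y / x + y}.
  by move=> x y; rewrite -{1}[y]opprK -[- y]sub0r !thB th0 sub0r opprK.
have coeff r i j : exists x, theta x == b i * r * a j.
  suff /thP[x <-] : e * (b i * r * a j) * e = b i * r * a j by exists x.
  by rewrite !mulrA eb -mulrA ae.
pose f r : 'M[F]_m.+1 := \matrix_(i, j) xchoose (coeff r i j).
have fE r i j : theta (f r i j) = b i * r * a j.
  by rewrite mxE; apply/eqP/(xchooseP (coeff r i j)).
have f_sub : zmod_morphism f.
  move=> r s; apply/matrixP=> i j; apply: th_inj.
  have -> : (f r - f s) i j = f r i j - f s i j by rewrite !mxE.
  by rewrite thB !fE mulrBr mulrBl.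
have f_mul : monoid_morphism f.
  split=> [|r s]; apply/matrixP=> i j; apply: th_inj.
    by rewrite fE mulr1 ba mxE; case: eqP.
  have -> : (f r * f s) i j = \sum_k f r i k * f s k j by rewrite mxE.
  have rsE : r * s = \sum_k r * (a k * b k) * s.
    by rewrite -mulr_suml -mulr_sumr ab1 mulr1.
  rewrite fE (big_morph theta thD th0) rsE mulr_sumr mulr_suml.
  by apply: eq_bigr => k _; rewrite thM !fE !mulrA.
pose fA := GRing.isZmodMorphism.Build R 'M[F]_m.+1 f f_sub.
pose fM := GRing.isMonoidMorphism.Build R 'M[F]_m.+1 f f_mul.
pose fR : {rmorphism R -> 'M[F]_m.+1} := HB.pack f fA fM.
exists fR.
exists (fun A : 'M[F]_m.+1 => \sum_i \sum_j a i * theta (A i j) * b j).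
  move=> r; rewrite -[RHS]mul1r -[RHS]mulr1 -ab1 mulr_suml mulr_suml.
  apply: eq_bigr => i _; rewrite mulr_sumr; apply: eq_bigr => j _.
  by rewrite fE !mulrA.
move=> A; apply/matrixP=> i j; apply: th_inj; rewrite fE.
rewrite mulr_sumr mulr_suml (bigD1 i) //= [X in _ + X]big1 ?addr0 => [|k ki].
  rewrite mulr_sumr mulr_suml (bigD1 j) //= big1 ?addr0 => [|k kj].
    rewrite -!mulrA ba eqxx mulr1n !mulrA ba eqxx mulr1n -th1 -!thM.
    by rewrite mul1r mulr1.
  by rewrite -!mulrA ba (negPf kj) mulr0n !mulr0.
rewrite mulr_sumr mulr_suml big1 // => l _.
by rewrite !mulrA ba [i == k]eq_sym (negPf ki) mulr0n !mul0r.
Qed.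

(* The positive integer is m.+1: 'M[F]_n carries a canonical finite ring
   structure only for n of this form. *)
Theorem theorem5p2 (m : nat) (m1_neq1 : m.+1 <> 1%N)
    (F : finFieldType) (R : finPzRingType) :
  digraph_iso (Theta (R := R)) (Theta (R := 'M[F]_m.+1)) ->
  ring_iso R 'M[F]_m.+1.
Proof.
move=> [f [g fK gK] fE].
have [phi phiE] := fin_all_exists (fun x => class_surj (g (class x))).
have phi_mul0 x y : (phi x * phi y == 0) = (x * y == 0).
  by rewrite -Theta_edgeE -!phiE -fE !gK Theta_edgeE.
have phi_surj r : exists x, class r = class (phi x).
  have [x fx] := class_surj (f (class r)); exists x.
  by rewrite -phiE -fx fK.
have [e [sum_e e_orth e_mul0 mul_e0]] := exists_frame phi_mul0 phi_surj.
have [a [b [aP bP ba ab]]] :=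
  exists_matrix_units phi_mul0 phi_surj sum_e e_orth e_mul0 mul_e0.
have e0_idem := e_idem sum_e e_orth 0.
have [s es nzs|K [theta [th_inj th1 thB thM thP]]] :=
    corner_field e0_idem (e_neq0 phi_mul0 phi_surj e_mul0 0).
  have [t [et st _]] :=
    corner_inv phi_mul0 phi_surj sum_e e_orth e_mul0 mul_e0 es nzs.
  by exists t.
have o_neq0 : ord_max != 0 :> 'I_m.+1.
  by apply/eqP=> /(congr1 val) /= m0; apply: m1_neq1; rewrite m0.
have [h h_bij] := finField_isom (card_corner_field phi_mul0 phi_surj sum_e
  e_orth e_mul0 mul_e0 o_neq0 aP bP ba ab th_inj thP).
have [h' hK h'K] := h_bij.
apply: (@matrix_units_ring_iso _ _ _ a b (e 0) (theta \o h)) => //=.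
- by move=> i; case: (aP i).
- by move=> i; case: (bP i).
- move=> i j; have [->|ij] := eqVneq i j; first exact: ba.
  rewrite -(bP i).2 -mulrA -(aP j).1 [e i * _]mulrA e_orth //.
  by rewrite mul0r mulr0.
- by rewrite -sum_e; apply: eq_bigr => i _.
- by move=> x y /th_inj /(bij_inj h_bij).
- by rewrite rmorph1.
- by move=> x y /=; rewrite rmorphB thB.
- by move=> x y /=; rewrite rmorphM thM.
- move=> s; split=> [/thP[z <-]|[x <-]]; last by apply/thP; exists (h x).
  by exists (h' z); rewrite h'K.
Qed.
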